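(* Let $m\ge 4$, $\beta\ge\ln 4$ and $\epsilon>0$. The utilitarian distortion of the Plurality rule with $m$ candidates under the Plackett–Luce model with parameter $\beta$ satisfies $$\mathcal{D}_{m,\beta}(\mathrm{Plurality})\;\ge\;\min\left(\frac{e^{\beta}}{2+\epsilon}-1,\ \frac{m}{2+\epsilon}-1\right).$$
   Context: Setting. $C$ is a set of $m$ candidates and $\beta\ge 1$ is a real parameter. Let $\mathcal{V}$ be a probability distribution on $[0,1]^C$ (utility vectors). For each $n$, the utility vectors $\mathbf{u}_1,\dots,\mathbf{u}_n$ of $n$ voters are drawn i.i.d. from $\mathcal{V}$, with $u_{i,j}\in[0,1]$ the utility of voter $i$ for candidate $j$. Given the utilities, each voter $i$ independently submits a random ranking $\pi_i$ of $C$ drawn from the Plackett–Luce model: positions are filled from top to bottom, and at each step a candidate $j$ is chosen among the not yet ranked candidates with probability proportional to $e^{\beta u_{i,j}}$. A voting rule $f$ maps each profile $\pi^n=(\pi_1,\dots,\pi_n)$ (for every $n$) to a probability distribution over $C$; it is deterministic if it always selects a single winner. Put $\mathrm{Util}_j=\mathbb{E}_{\mathbf{u}\sim\mathcal{V}}[u_j]$ and $\mathrm{Util}_n(f)=\mathbb{E}\big[\tfrac1n\sum_{i=1}^n u_{i,f(\pi^n)}\big]$, the expectation being over utilities, rankings and any internal randomness of $f$. The utilitarian distortion is $$\mathcal{D}_{m,\beta}(f)=\sup_{\mathcal{V}}\ \limsup_{n\to\infty}\ \frac{\max_{j\in C}\mathrm{Util}_j}{\mathrm{Util}_n(f)},$$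 with the ratio taken to be $1$ if numerator and denominator are both $0$. Plurality rule. Selects the candidate ranked first by the largest number of voters (ties broken by an arbitrary fixed rule). *)

(* Defs.v *)
From HB Require Import structures.
From mathcomp Require Import all_boot all_order all_algebra perm.
From mathcomp Require Import all_classical all_reals all_analysis.

Set Implicit Arguments.
Unset Strict Implicit.
Unset Printing Implicit Defensive.

Import Order.TTheory GRing.Theory Num.Theory.
Import numFieldNormedType.Exports.

Local Open Scope classical_set_scope.
Local Open Scope ring_scope.

(* The candidates are 'I_m and the voters are 'I_n. *)

(* iid P n is the law of n independent draws from P, i.e. the n-fold product
   measure on n-tuples; it is characterized by iid_box below. *)
Section iid.
Context d (T : measurableType d) (R : realType) (P : probability T R).

Definition tuple_cons n (x : T * n.-tuple T) : n.+1.-tuple T :=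
  [tuple of x.1 :: x.2].

Lemma measurable_tuple_cons n : measurable_fun setT (@tuple_cons n).
Proof. exact: (measurable_cons measurable_fst measurable_snd). Qed.

HB.instance Definition _ n :=
  isMeasurableFun.Build _ _ _ _ (@tuple_cons n) (@measurable_tuple_cons n).

Fixpoint iid n : probability (n.-tuple T) R :=
  match n with
  | 0 => \d_([tuple] : 0.-tuple T)
  | n'.+1 => distribution (P \x iid n')%E (@tuple_cons n')
  end.

Lemma measurable_box n (A : 'I_n -> set T) : (forall i, measurable (A i)) ->
  measurable [set t : n.-tuple T | forall i, A i (tnth t i)].
Proof.
move=> mA; rewrite [X in measurable X](_ : _ =
    \bigcap_(i in [set: 'I_n]) ((@tnth n T)^~ i @^-1` A i)); last first.
  by apply/seteqP; split=> [t tA i _|t tA i]; [exact: tA|exact: (tA i)].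
apply: fin_bigcap_measurable; first exact: finite_finset.
move=> i _; rewrite -[X in measurable X]setTI.
by apply: (measurable_tnth i) => //; exact: mA.
Qed.

Lemma iid_box n (A : 'I_n -> set T) : (forall i, measurable (A i)) ->
  iid n [set t | forall i, A i (tnth t i)] = (\prod_(i < n) P (A i))%E.
Proof.
elim: n A => [|n IHn] A mA.
  rewrite big_ord0 /= diracE mem_set//= => -[].
  by [].
rewrite big_ord_recl /= /distribution /pushforward -IHn; last by [].
rewrite -product_measure1E; first last.
- exact: (measurable_box (A := fun i => A (lift ord0 i))).
- exact: mA.
congr ((P \x iid n)%E _); apply/seteqP; split=> [[x t] /= tA|[x t] /= [xA tA] i].
  split; first by have := tA ord0; rewrite (tnth_nth x).
  by move=> i; have := tA (lift ord0 i); rewrite tnthS.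
by have [j ->|->] := unliftP ord0 i; rewrite ?tnthS.
Qed.

End iid.

Section voting.
Context (R : realType) (m : nat).
Implicit Types (beta : R) (n : nat).

(* u : m.-tuple R is a utility vector: tnth u j is the utility of candidate j.
   A distribution on [0, 1]^m is a probability measure on R^m carried by the
   cube. *)
Definition unit_cube : set (m.-tuple R) :=
  [set u | forall j, 0 <= tnth u j <= 1].

Definition utility_distributions : set (probability (m.-tuple R) R) :=
  [set V | V unit_cube = 1%E].

(* A ranking s : 'S_m sends each position to the candidate placed there;
   position 0 is the top one. *)

(* At position k the candidates not yet ranked are those at the positions
   l >= k. *)
Definition plackett_luce beta (u : m.-tuple R) (s : 'S_m) : R :=
  \prod_(k < m) (expR (beta * tnth u (s k)) /
                 \sum_(l < m | (k <= l)%N) expR (beta * tnth u (s l))).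

Record lottery := Lottery {
  lottery_prob :> 'I_m -> R;
  lottery_ge0 : forall j, 0 <= lottery_prob j;
  lottery_sum1 : \sum_(j < m) lottery_prob j = 1 }.

Definition voting_rule := forall n, n.-tuple 'S_m -> lottery.

Definition deterministic (f : voting_rule) :=
  forall n (p : n.-tuple 'S_m), exists w, f n p w = 1.

Definition first_places n (p : n.-tuple 'S_m) (j : 'I_m) : nat :=
  count (fun s : 'S_m => [exists k : 'I_m, (k == 0%N :> nat) && (s k == j)]) p.

(* The Plurality rules, one for each way of breaking ties. *)
Definition is_plurality (f : voting_rule) :=
  deterministic f /\
  forall n (p : n.-tuple 'S_m) w, f n p w = 1 ->
    forall j, (first_places p j <= first_places p w)%N.

Local Open Scope ereal_scope.

Definition util (V : probability (m.-tuple R) R) (j : 'I_m) : \bar R :=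
  'E_V[fun u => tnth u j].

(* Expectation over the rankings and the randomness of f, given the
   utilities u. *)
Definition cond_util beta (f : voting_rule) n (u : n.-tuple (m.-tuple R)) : R :=
  (\sum_(p : n.-tuple 'S_m)
     (\prod_(i < n) plackett_luce beta (tnth u i) (tnth p i)) *
     \sum_(w < m) f n p w * (n%:R^-1 * \sum_(i < n) tnth (tnth u i) w))%R.

Definition rule_util beta (f : voting_rule) (V : probability (m.-tuple R) R) n
  : \bar R := 'E_(iid V n)[@cond_util beta f n].

(* In \bar R, a / 0 = +oo for a > 0. *)
Definition util_ratio (a b : \bar R) : \bar R :=
  if (a == 0) && (b == 0) then 1 else a / b.

Definition distortion beta (f : voting_rule) : \bar R :=
  ereal_sup [set limn_esup (fun n =>
                   util_ratio (\big[maxe/-oo]_(j < m) util V j)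
                              (rule_util beta f V n))
            | V in utility_distributions].

End voting.

(* Main.v *)
(* Write M = e^beta, let K = min(M, m) and fix a candidate, here [ord0].  With
   probability p = 2/K a voter gives utility 1 to [ord0] and 0 to all others;
   otherwise utility 0 to [ord0] and 1 to all others.  In the second case the
   first place is shared among the m - 1 good candidates, so a first-place vote
   for [ord0] in the first case outweighs many of them: [ord0] leads every rival
   in expected first places because
     (K - 2) (M + m - 1) < 2 (1 + (m - 1) M).
   By Chebyshev's inequality [ord0] wins with probability 1 - O(1/n), so the
   utility of Plurality is at most p + O(1/n) while the other candidates have
   utility 1 - p, and (1 - p) / p = K/2 - 1.  Since the distribution has two
   atoms, all expectations are finite sums over pairs (voter type, ranking). *)
Require Import Defs.
From HB Require Import structures.
From mathcomp Require Import all_boot all_order all_algebra perm.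
From mathcomp Require Import all_classical all_reals all_analysis.
From mathcomp Require Import measurable_realfun.
From mathcomp Require Import ring lra.

Set Implicit Arguments.
Unset Strict Implicit.
Unset Printing Implicit Defensive.

Import Order.TTheory GRing.Theory Num.Theory.

Local Open Scope classical_set_scope.
Local Open Scope ring_scope.

(** * Sums over tuples and measures with finitely many atoms *)

Lemma big_tuple_cons (R : Type) (idx : R) (op : Monoid.com_law idx)
    (T : finType) n (F : n.+1.-tuple T -> R) :
  \big[op/idx]_t F t = \big[op/idx]_x \big[op/idx]_(t : n.-tuple T) F [tuple of x :: t].
Proof.
rewrite pair_big (reindex (fun z : T * n.-tuple T => [tuple of z.1 :: z.2])) //=.
exists (fun t => (thead t, [tuple of behead t])) => [[x t] _|t _] /=.
  by rewrite theadE; congr pair; apply: val_inj.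
by rewrite -tuple_eta.
Qed.

Section atomic_measure.
Context (R : realType) (I : finType).

(* [mu] is the sum of the point masses [w i] at [c i]. *)
Definition atomic d (T : measurableType d) (mu : {measure set T -> \bar R})
    (w : I -> R) (c : I -> T) :=
  forall F : T -> \bar R, measurable_fun setT F -> (forall x, 0 <= F x)%E ->
  (\int[mu]_x F x = \sum_i (w i)%:E * F (c i))%E.

End atomic_measure.

(** The utility of a rule is nonnegative on the cube but may be negative elsewhere on [m.-tuple R].
    Its negative part vanishes at every atom, hence integrates to 0. *)
Lemma atomic_integral (R : realType) (I : finType) d (T : measurableType d)
    (mu : {measure set T -> \bar R}) (w : I -> R) (c : I -> T) (F : T -> R) :
  atomic mu w c -> measurable_fun setT F -> (forall i, 0 <= F (c i)) ->
  (\int[mu]_x (F x)%:E = (\sum_i w i * F (c i))%:E)%E.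
Proof.
move=> muE /measurable_EFinP mF F0.
rewrite integralE !muE //; try exact: measurable_funepos; try exact: measurable_funeneg.
rewrite [X in (_ - X)%E]big1 => [|i _].
  rewrite sube0 -sumEFin; apply: eq_bigr => i _.
  by rewrite funeposE /= max_l ?lee_fin.
by rewrite funenegE /= max_r ?mule0 // lee_fin oppr_le0.
Qed.

(** Tonelli splits off the first draw; the induction hypothesis turns the inner integral into a
    finite sum, and [PE] evaluates the outer one. *)
Lemma atomic_iid (R : realType) (I : finType) d (T : measurableType d)
    (P : probability T R) (w : I -> R) (c : I -> T) n :
  (forall i, 0 <= w i) -> atomic P w c ->
  atomic (iid P n) (fun t : n.-tuple I => \prod_(i < n) w (tnth t i)) (map_tuple c).
Proof.
move=> w0 PE; elim: n => [|n IHn] F mF F0.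
  rewrite /= integral_dirac // diracT mul1e.
  rewrite (big_pred1 [tuple]) => [|t]; last by apply/esym/eqP; exact: tuple0.
  by rewrite big_ord0 mul1e; congr F; apply: val_inj.
have mFc : measurable_fun setT (F \o @tuple_cons _ T n).
  by apply: measurableT_comp => //; exact: measurable_tuple_cons.
rewrite [LHS](@ge0_integral_pushforward _ _ _ _ _ _ (@measurable_tuple_cons _ T n)
  (P \x iid P n)%E) //.
rewrite preimage_setT fubini_tonelli1 //=.
have mFx x : measurable_fun setT (fun t => F (tuple_cons (x, t))).
  by apply: (measurableT_comp mFc); exact: pair1_measurable.
have mFt t : measurable_fun setT (fun x => F (tuple_cons (x, t))).
  by apply: (measurableT_comp mFc); exact: pair2_measurable.
rewrite /fubini_F (eq_integral (fun x => \sum_(t : n.-tuple I)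
    (\prod_(i < n) w (tnth t i))%:E * F (tuple_cons (x, map_tuple c t))))%E; last first.
  by move=> x _; rewrite IHn //= => ?; exact: F0.
have p0 (t : n.-tuple I) : 0 <= \prod_(i < n) w (tnth t i) by exact: prodr_ge0.
rewrite PE; last 2 first.
- apply: emeasurable_sum => t; exact: measurable_funeM.
- by move=> x; apply: sume_ge0 => t _; rewrite mule_ge0 // lee_fin.
rewrite big_tuple_cons; apply: eq_bigr => x _.
rewrite ge0_sume_distrr => [|t _]; last by rewrite mule_ge0 // lee_fin.
apply: eq_bigr => t _; rewrite muleA -EFinM big_ord_recl (tnth_nth x) /=.
congr (_%:E * F _)%E; last exact: val_inj.
by congr *%R; apply: eq_bigr => i _; rewrite tnthS.
Qed.

(** * First and second moments of i.i.d. sums *)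

Section iid_moments.
Context (R : realFieldType) (T : finType) (q : T -> R).
Hypothesis q1 : \sum_x q x = 1.

Definition prod_weight n (t : n.-tuple T) := \prod_(i < n) q (tnth t i).

Lemma prod_weight_cons n x (t : n.-tuple T) :
  prod_weight [tuple of x :: t] = q x * prod_weight t.
Proof.
rewrite /prod_weight big_ord_recl (tnth_nth x) /=; congr *%R.
by apply: eq_bigr => i _; rewrite tnthS.
Qed.

Lemma sum_tuple_cons n (X : T -> R) x (t : n.-tuple T) :
  \sum_(i < n.+1) X (tnth [tuple of x :: t] i) = X x + \sum_(i < n) X (tnth t i).
Proof.
rewrite big_ord_recl (tnth_nth x) /=; congr +%R.
by apply: eq_bigr => i _; rewrite tnthS.
Qed.

Lemma sum_prod_weight n : \sum_(t : n.-tuple T) prod_weight t = 1.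
Proof.
elim: n => [|n IHn].
  rewrite (big_pred1 [tuple]) => [|t]; last by apply/esym/eqP; exact: tuple0.
  by rewrite /prod_weight big_ord0.
rewrite big_tuple_cons -[RHS]q1; apply: eq_bigr => x _.
under eq_bigr do rewrite prod_weight_cons.
by rewrite -mulr_sumr IHn mulr1.
Qed.

Lemma iid_mean n (X : T -> R) :
  \sum_(t : n.-tuple T) prod_weight t * \sum_(i < n) X (tnth t i) =
  n%:R * \sum_x q x * X x.
Proof.
elim: n => [|n IHn].
  by rewrite mul0r big1 // => t _; rewrite big_ord0 mulr0.
rewrite big_tuple_cons.
have inner x : \sum_(t : n.-tuple T) prod_weight [tuple of x :: t] *
    (\sum_(i < n.+1) X (tnth [tuple of x :: t] i)) =
    q x * X x + q x * (n%:R * \sum_x q x * X x).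
  under eq_bigr do rewrite prod_weight_cons sum_tuple_cons mulrDr -mulrA
    [in X in _ + X]mulrAC -mulrA [prod_weight _ * _ in X in X + _]mulrC.
  rewrite big_split /=; congr +%R.
    by rewrite -mulr_sumr -mulr_sumr sum_prod_weight mulr1.
  rewrite -IHn mulr_sumr; apply: eq_bigr => t _; ring.
by rewrite (eq_bigr _ (fun x _ => inner x)) big_split /= -mulr_suml q1; ring.
Qed.

(** When the square is expanded around the first draw, the cross term carries the mean of the
    remaining sum, which is 0 by [iid_mean]; so the variances add up. *)
Lemma iid_variance n (X : T -> R) : \sum_x q x * X x = 0 ->
  \sum_(t : n.-tuple T) prod_weight t * (\sum_(i < n) X (tnth t i)) ^+ 2 =
  n%:R * \sum_x q x * X x ^+ 2.
Proof.
move=> X0; elim: n => [|n IHn].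
  by rewrite mul0r big1 // => t _; rewrite big_ord0 expr0n mulr0.
rewrite big_tuple_cons.
have inner x : \sum_(t : n.-tuple T) prod_weight [tuple of x :: t] *
    (\sum_(i < n.+1) X (tnth [tuple of x :: t] i)) ^+ 2 =
    q x * X x ^+ 2 + q x * (n%:R * \sum_x q x * X x ^+ 2).
  transitivity (\sum_(t : n.-tuple T) (q x * X x ^+ 2 * prod_weight t +
     q x * X x * 2 * (prod_weight t * \sum_(i < n) X (tnth t i)) +
     q x * (prod_weight t * (\sum_(i < n) X (tnth t i)) ^+ 2))).
    by apply: eq_bigr => t _; rewrite prod_weight_cons sum_tuple_cons; ring.
  by rewrite !big_split /= -!mulr_sumr sum_prod_weight iid_mean X0 IHn; ring.
by rewrite (eq_bigr _ (fun x _ => inner x)) big_split /= -mulr_suml q1; ring.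
Qed.

End iid_moments.

(** * Plackett-Luce: total mass and law of the top position *)

Section plackett_luce_weights.
Context (R : realFieldType).

(** Arbitrary weights replace the exponentials of [plackett_luce], so that removing a candidate
    stays within the family and induction on [m] is possible. *)
Definition pl_prob m (w : 'I_m -> R) (s : 'S_m) : R :=
  \prod_(k < m) (w (s k) / \sum_(l < m | (k <= l)%N) w (s l)).

(** The denominators below the top omit [w j], so after the choice of [j] the rest is a
    Plackett-Luce ranking of the other candidates. *)
Lemma pl_prob_lift_perm m (w : 'I_m.+1 -> R) j (s : 'S_m) :
  pl_prob w (lift_perm ord0 j s) = w j / (\sum_i w i) * pl_prob (w \o lift j) s.
Proof.
rewrite /pl_prob big_ord_recl lift_perm_id; congr (_ / _ * _).
  by rewrite [RHS](reindex_inj (@perm_inj _ (lift_perm ord0 j s))).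
apply: eq_bigr => k _; rewrite lift_perm_lift; congr (_ / _).
rewrite big_mkcond big_ord_recl /= add0r [RHS]big_mkcond.
by apply: eq_bigr => l _; rewrite lift_perm_lift.
Qed.

Lemma big_perm_lift (A : Type) (idx : A) (op : Monoid.com_law idx) m
    (j : 'I_m.+1) (F : 'S_m.+1 -> A) :
  \big[op/idx]_(s : 'S_m.+1 | s ord0 == j) F s =
  \big[op/idx]_(s : 'S_m) F (lift_perm ord0 j s).
Proof.
have inj_lift : injective (@lift_perm m ord0 j).
  move=> s t /permP st; apply/permP => k.
  by apply: (@lift_inj _ j); rewrite -!(lift_perm_lift ord0).
transitivity (\big[op/idx]_(s in lift_perm ord0 j @: [set: 'S_m]%SET) F s).
  apply: eq_bigl => s; apply/eqP/imsetP => [sj|[t _ ->]]; last exact: lift_perm_id.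
  (* Delete the top position of [s] and relabel the candidates other than [j]. The default [k] is
     never taken, since [s] places [j] only at the top. *)
  pose g k := odflt k (unlift j (s (lift ord0 k))).
  have gE k : lift j (g k) = s (lift ord0 k).
    rewrite /g; case: unliftP => [k' ->//|/eqP].
    by rewrite -sj (inj_eq perm_inj) eq_sym (negPf (neq_lift _ _)).
  have g_inj : injective g.
    by move=> k l /(congr1 (lift j)); rewrite !gE => /perm_inj/lift_inj.
  exists (perm g_inj); first by rewrite inE.
  apply/permP => k.
  have [k' ->|->] := unliftP ord0 k; last by rewrite lift_perm_id.
  by rewrite lift_perm_lift permE gE.
by rewrite big_imset => [|s t _ _ /inj_lift //]; apply: eq_bigl => s; rewrite inE.
Qed.

Lemma sum_pl_prob m (w : 'I_m -> R) : (forall j, 0 < w j) -> \sum_s pl_prob w s = 1.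
Proof.
elim: m w => [|m IHm] w w0.
  rewrite (big_pred1 (1%g : 'S_0)) => [|s]; first by rewrite /pl_prob big_ord0.
  by apply/esym/eqP/permP => -[].
rewrite (partition_big (fun s : 'S_m.+1 => s ord0) xpredT) //=.
have sw0 : 0 < \sum_i w i.
  by rewrite big_ord_recl ltr_pwDl // sumr_ge0 // => i _; exact: ltW.
rewrite -(divff (lt0r_neq0 sw0)) mulr_suml; apply: eq_bigr => j _.
rewrite big_perm_lift; under eq_bigr do rewrite pl_prob_lift_perm.
by rewrite -mulr_sumr IHm ?mulr1 // => i; exact: w0.
Qed.

Lemma sum_pl_prob_top m (w : 'I_m.+1 -> R) j : (forall j, 0 < w j) ->
  \sum_(s : 'S_m.+1 | s ord0 == j) pl_prob w s = w j / \sum_i w i.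
Proof.
move=> w0; rewrite big_perm_lift; under eq_bigr do rewrite pl_prob_lift_perm.
by rewrite -mulr_sumr sum_pl_prob ?mulr1 // => i; exact: w0.
Qed.

End plackett_luce_weights.

(** * Pointwise bound on the winner's utility *)

Section plurality_winner.
Context (R : realType) (m : nat).

Lemma first_placesE n (p : n.-tuple 'S_m.+1) j :
  (first_places p j)%:R = \sum_(i < n) (tnth p i ord0 == j)%:R :> R.
Proof.
rewrite /first_places -sum1_count big_tuple big_mkcond natr_sum.
apply: eq_bigr => i _; congr _%:R.
rewrite (_ : [exists k, _] = (tnth p i ord0 == j)); first by case: ifP.
by apply/existsP/idP => [[k /andP[/eqP k0]]|ij];
  [rewrite (_ : k = ord0) //; exact: val_inj | exists ord0].
Qed.

(** A union bound before averaging: either [B] wins, or the winner has at least as many first places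
    as [B] and its indicator in the sum dominates its value, which is at most 1. *)
Lemma plurality_le (f : voting_rule R m.+1) n (p : n.-tuple 'S_m.+1) B
    (a : 'I_m.+1 -> R) :
  is_plurality f -> (forall j, 0 <= a j <= 1) ->
  \sum_w f n p w * a w <=
    a B + \sum_(j | j != B) (first_places p B <= first_places p j)%N%:R.
Proof.
move=> [fdet fmax] a01; have [w fw] := fdet n p.
have f0 j : j != w -> f n p j = 0.
  move=> jw; have := lottery_sum1 (f n p).
  rewrite (bigD1 w) //= fw => /eqP; rewrite -subr_eq0 addrAC subrr add0r => s0.
  have /psumr_eq0P s0' : forall i, i != w -> 0 <= f n p i.
    by move=> i _; exact: lottery_ge0.
  by apply: s0' => //; exact/eqP.
rewrite (bigD1 w) //= fw mul1r big1 ?addr0 => [|j /f0 ->]; last by rewrite mul0r.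
have s0 : 0 <= \sum_(j | j != B) (first_places p B <= first_places p j)%N%:R :> R.
  by apply: sumr_ge0.
have [->|wB] := eqVneq w B; first by rewrite lerDl.
rewrite (bigD1 w) //= (fmax _ _ _ fw) addrCA.
have [_ aw1] := andP (a01 w); have [aB0 _] := andP (a01 B).
apply: (le_trans aw1); rewrite lerDl addr_ge0 //; exact: sumr_ge0.
Qed.

End plurality_winner.

(** * Measurability of the conditional utility *)

Section measurability.
Context (R : realType).

Lemma measurable_plackett_luce m (beta : R) (s : 'S_m) :
  measurable_fun setT (fun u : m.-tuple R => plackett_luce beta u s).
Proof.
have mexp j : measurable_fun setT (fun u : m.-tuple R => expR (beta * tnth u j)).
  apply: measurableT_comp => //; apply: measurable_funM => //.
  exact: measurable_tnth.
apply: measurable_prod => k _; apply: measurable_funM => //.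
(* Inversion is the power -1 on nonnegative reals, and the denominators are sums of exponentials. *)
rewrite (_ : (fun _ => _) = (@powR R)^~ (-1) \o
    (fun u : m.-tuple R => \sum_(l < m | (k <= l)%N) expR (beta * tnth u (s l)))).
  apply: measurableT_comp => //.
  rewrite (_ : (fun _ => _) = fun u : m.-tuple R =>
      \sum_(l < m) if (k <= l)%N then expR (beta * tnth u (s l)) else 0).
    by apply: measurable_sum => l; case: (k <= l)%N.
  by apply/funext => u; rewrite big_mkcond.
by apply/funext => u /=; rewrite powR_inv1 // sumr_ge0 // => l _; exact: expR_ge0.
Qed.

Lemma measurable_cond_util m (beta : R) (f : voting_rule R m) n :
  measurable_fun setT (@cond_util R m beta f n).
Proof.
apply: measurable_sum => p; apply: measurable_funM.
  apply: measurable_prod => i _.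
  apply: (measurableT_comp (measurable_plackett_luce beta _)).
  exact: measurable_tnth.
apply: measurable_sum => w; apply: measurable_funM => //.
apply: measurable_funM => //; apply: measurable_sum => i.
apply: (measurableT_comp (@measurable_tnth _ _ _ w)).
exact: measurable_tnth.
Qed.

End measurability.

(** * Plurality on the electorate with two voter types *)

Section two_point.
Context (R : realType) (m : nat).

Definition polar_utility (b : bool) : m.+1.-tuple R :=
  [tuple ((j == ord0) == b)%:R | j < m.+1].

Lemma measurable_polar_utility : measurable_fun setT polar_utility.
Proof. by []. Qed.

HB.instance Definition _ := isMeasurableFun.Build _ _ _ _ polar_utility
  measurable_polar_utility.

Definition polar_distribution (p : R) : probability (m.+1.-tuple R) R :=
  distribution (bernoulli_prob p) polar_utility.

Variable p : R.
Hypothesis p01 : 0 <= p <= 1.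

Lemma atomic_polar_distribution :
  atomic (polar_distribution p) (bernoulli_pmf p) polar_utility.
Proof.
move=> F mF F0.
rewrite [LHS](@ge0_integral_pushforward _ _ _ _ _ _ measurable_polar_utility
  (bernoulli_prob p)) // preimage_setT integral_bernoulli_prob //.
  by rewrite big_bool.
by move=> b; exact: F0.
Qed.

Lemma polar_distribution_cube : utility_distributions (polar_distribution p).
Proof.
rewrite /utility_distributions /= /distribution /pushforward.
rewrite (_ : _ @^-1` _ = setT) ?probability_setT //.
apply/seteqP; split=> // b _ j; rewrite tnth_mktuple.
by case: (_ == b); rewrite ?lexx ler01.
Qed.

Lemma util_polar_distribution j :
  util (polar_distribution p) j = (if j == ord0 then p else 1 - p)%:E.
Proof.
rewrite /util unlock (atomic_integral atomic_polar_distribution) //=.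
- rewrite big_bool /= !tnth_mktuple; congr _%:E.
  by case: (j == ord0) => /=; rewrite !mulr0 !mulr1 ?addr0 ?add0r.
- exact: measurable_tnth.
- by move=> b; rewrite tnth_mktuple.
Qed.

Variable beta : R.

(** The joint law of one voter's type and ranking; by independence its [prod_weight] is the law of
    the whole electorate. *)
Definition ballot_prob (z : bool * 'S_m.+1) : R :=
  bernoulli_pmf p z.1 * plackett_luce beta (polar_utility z.1) z.2.

Lemma plackett_luce_ge0 u (s : 'S_m.+1) : 0 <= plackett_luce beta u s.
Proof.
apply: prodr_ge0 => k _; rewrite divr_ge0 ?expR_ge0 // sumr_ge0 //.
Qed.

Lemma ballot_prob_ge0 z : 0 <= ballot_prob z.
Proof. by rewrite mulr_ge0 ?bernoulli_pmf_ge0 ?plackett_luce_ge0. Qed.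

Lemma sum_ballot_prob_fst (F : bool -> R) :
  \sum_z ballot_prob z * F z.1 = \sum_b bernoulli_pmf p b * F b.
Proof.
rewrite -(pair_bigA _ (fun b s => ballot_prob (b, s) * F b)) /=.
apply: eq_bigr => b _; rewrite -mulr_suml -mulr_sumr.
rewrite [X in _ * X * _](_ : _ = 1) ?mulr1 //.
apply: (sum_pl_prob (w := fun j => expR (beta * tnth (polar_utility b) j))).
by move=> j; exact: expR_gt0.
Qed.

Lemma sum_ballot_prob : \sum_z ballot_prob z = 1.
Proof.
under eq_bigr do rewrite -[ballot_prob _]mulr1.
by rewrite (sum_ballot_prob_fst (fun=> 1)) big_bool /= !mulr1 addrC subrK.
Qed.

Lemma sum_exp_polar_utility b :
  \sum_(j < m.+1) expR (beta * tnth (polar_utility b) j) =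
  if b then expR beta + m%:R else 1 + m%:R * expR beta.
Proof.
rewrite big_ord_recl tnth_mktuple eqxx.
under eq_bigr => j _ do rewrite tnth_mktuple lift_eqF.
rewrite sumr_const card_ord.
by case: b; rewrite /= !(mulr0, mulr1) expR0 // mulr_natl.
Qed.

Lemma sum_ballot_prob_top j :
  \sum_z ballot_prob z * (z.2 ord0 == j)%:R =
  if j == ord0 then p * (expR beta / (expR beta + m%:R)) +
    (1 - p) * (1 / (1 + m%:R * expR beta))
  else p * (1 / (expR beta + m%:R)) +
    (1 - p) * (expR beta / (1 + m%:R * expR beta)).
Proof.
rewrite -(pair_bigA _ (fun b s => ballot_prob (b, s) * (s ord0 == j)%:R)) /=.
have inner b : \sum_(s : 'S_m.+1) ballot_prob (b, s) * (s ord0 == j)%:R =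
    bernoulli_pmf p b * (expR (beta * tnth (polar_utility b) j) /
      \sum_(i < m.+1) expR (beta * tnth (polar_utility b) i)).
  rewrite -(sum_pl_prob_top (w := fun j => expR (beta * tnth (polar_utility b) j)));
    last by move=> i; exact: expR_gt0.
  rewrite mulr_sumr [RHS]big_mkcond; apply: eq_bigr => s _.
  by case: eqP; rewrite ?mulr1 ?mulr0.
rewrite big_bool /= !inner !sum_exp_polar_utility !tnth_mktuple.
by case: (j == ord0); rewrite /= !(mulr0, mulr1) expR0.
Qed.

(* Expected lead in first places of [ord0] over any other candidate, per voter. *)
Definition top_gap : R := (expR beta - 1) *
  (p / (expR beta + m%:R) - (1 - p) / (1 + m%:R * expR beta)).

Lemma sum_ballot_prob_gap j : j != ord0 ->
  \sum_z ballot_prob z *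
    ((z.2 ord0 == ord0)%:R - (z.2 ord0 == j)%:R - top_gap) = 0.
Proof.
move=> j0; under eq_bigr do rewrite !mulrBr.
rewrite !sumrB -mulr_suml sum_ballot_prob !sum_ballot_prob_top eqxx (negPf j0).
by rewrite /top_gap; ring.
Qed.

Variable f : voting_rule R m.+1.
Hypothesis f_plurality : is_plurality f.

Definition winner_util n (z : n.-tuple (bool * 'S_m.+1)) : R :=
  \sum_w f (map_tuple snd z) w *
    (n%:R^-1 * \sum_(i < n) tnth (polar_utility (tnth z i).1) w).

Lemma winner_util_ge0 n (z : n.-tuple _) : 0 <= winner_util z.
Proof.
apply: sumr_ge0 => w _; rewrite mulr_ge0 ?lottery_ge0 // mulr_ge0 ?invr_ge0 //.
by apply: sumr_ge0 => i _; rewrite tnth_mktuple.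
Qed.

(** The weight of the types followed by the rankings factors voter by voter, so zipping both tuples
    gives one sum over i.i.d. pairs, to which the moment lemmas apply. *)
Lemma rule_util_polar n : rule_util beta f (polar_distribution p) n =
  (\sum_(z : n.-tuple _) prod_weight ballot_prob z * winner_util z)%:E.
Proof.
rewrite /rule_util unlock.
have pmf0 b : 0 <= bernoulli_pmf p b by exact: bernoulli_pmf_ge0.
rewrite (atomic_integral (@atomic_iid _ _ _ _ _ _ _ n pmf0
  atomic_polar_distribution)); last 2 first.
- exact: measurable_cond_util.
- move=> t; apply: sumr_ge0 => s _; rewrite mulr_ge0 //.
    by apply: prodr_ge0 => i _; exact: plackett_luce_ge0.
  apply: sumr_ge0 => w _; rewrite mulr_ge0 ?lottery_ge0 // mulr_ge0 ?invr_ge0 //.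
  by apply: sumr_ge0 => i _; rewrite tnth_map tnth_mktuple.
congr _%:E; under eq_bigr do rewrite mulr_sumr.
rewrite pair_big /=.
rewrite (reindex (fun z : n.-tuple (bool * 'S_m.+1) =>
  (map_tuple fst z, map_tuple snd z))) /=; last first.
  exists (fun ts : n.-tuple bool * n.-tuple 'S_m.+1 =>
    [tuple of zip ts.1 ts.2]) => [z _|[t s] _].
    by apply: val_inj; rewrite /= zip_unzip.
  by congr pair; apply: val_inj; [apply: unzip1_zip | apply: unzip2_zip];
    rewrite !size_tuple.
apply: eq_bigr => z _; rewrite mulrA -big_split /=; congr (_ * _).
  by apply: eq_bigr => i _; rewrite !tnth_map.
apply: eq_bigr => w _; congr (_ * (_ * _)).
by apply: eq_bigr => i _; rewrite !tnth_map.
Qed.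

(* If [j] catches up with [ord0], the sum of the centred leads is at most
   [- n * top_gap]. *)
Lemma plurality_gap n (z : n.-tuple (bool * 'S_m.+1)) j : 0 < top_gap -> (0 < n)%N ->
  (first_places (map_tuple snd z) ord0 <= first_places (map_tuple snd z) j)%N%:R
  <= (\sum_(i < n) (((tnth z i).2 ord0 == ord0)%:R - ((tnth z i).2 ord0 == j)%:R -
        top_gap)) ^+ 2 / (n%:R * top_gap) ^+ 2.
Proof.
move=> gap0 n0; have ng0 : 0 < n%:R * top_gap by rewrite mulr_gt0 ?ltr0n.
case: leqP => [le|_]; last by rewrite divr_ge0 ?sqr_ge0.
set S := \sum_(i < n) _.
have gS : n%:R * top_gap <= - S.
  rewrite /S !sumrB sumr_const card_ord -[top_gap *+ n]mulr_natl opprB lerBrDr gerDl.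
  rewrite subr_le0; move: le; rewrite -(ler_nat R) !first_placesE.
  under eq_bigr do rewrite tnth_map.
  by under [leRHS]eq_bigr do rewrite tnth_map.
rewrite ler_pdivlMr ?exprn_gt0 // mul1r -[leRHS]sqrrN lerXn2r ?nnegrE ?(ltW ng0) //.
exact: le_trans (ltW ng0) gS.
Qed.

Definition gap_variance (j : 'I_m.+1) : R := \sum_z ballot_prob z *
  ((z.2 ord0 == ord0)%:R - (z.2 ord0 == j)%:R - top_gap) ^+ 2.

(** Chebyshev's inequality before averaging: each indicator from [plurality_le] is replaced by a
    scaled square, whose mean [iid_variance] computes. *)
Lemma winner_util_le n (z : n.-tuple (bool * 'S_m.+1)) : 0 < top_gap -> (0 < n)%N ->
  winner_util z <= n%:R^-1 * \sum_(i < n) (tnth z i).1%:R +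
    \sum_(j | j != ord0) (\sum_(i < n) (((tnth z i).2 ord0 == ord0)%:R -
      ((tnth z i).2 ord0 == j)%:R - top_gap)) ^+ 2 / (n%:R * top_gap) ^+ 2.
Proof.
move=> gap0 n0; rewrite /winner_util.
pose a w := n%:R^-1 * \sum_(i < n) tnth (polar_utility (tnth z i).1) w.
have a01 w : 0 <= a w <= 1.
  rewrite /a mulr_ge0 ?invr_ge0 ?sumr_ge0 //=; last first.
    by move=> i _; rewrite tnth_mktuple.
  rewrite mulrC ler_pdivrMr ?ltr0n // mul1r.
  apply: (@le_trans _ _ (\sum_(i < n) 1)); last by rewrite sumr_const card_ord.
  by apply: ler_sum => i _; rewrite tnth_mktuple lern1 leq_b1.
apply: (le_trans (plurality_le (map_tuple snd z) ord0 f_plurality a01)); apply: lerD.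
  rewrite le_eqVlt; apply/orP; left; apply/eqP; congr *%R.
  by apply: eq_bigr => i _; rewrite tnth_mktuple eqxx; case: (_.1).
by apply: ler_sum => j _; exact: plurality_gap.
Qed.

(** On averaging [winner_util_le], the first term has mean [p]. Each square has mean
    [n * gap_variance j], and its denominator is of order [n ^ 2]. *)
Lemma rule_util_polar_le n : 0 < top_gap -> (0 < n)%N ->
  (rule_util beta f (polar_distribution p) n <=
   (p + (\sum_(j | j != ord0) gap_variance j) / top_gap ^+ 2 / n%:R)%:E)%E.
Proof.
move=> gap0 n0; rewrite rule_util_polar lee_fin.
have n0' : n%:R != 0 :> R by rewrite pnatr_eq0 -lt0n.
have weight_ge0 (z : n.-tuple _) : 0 <= prod_weight ballot_prob z.
  by apply: prodr_ge0 => i _; exact: ballot_prob_ge0.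
apply: le_trans (ler_sum _ (fun z _ => ler_wpM2l (weight_ge0 z)
  (winner_util_le z gap0 n0))) _.
under eq_bigr do rewrite mulrDr.
rewrite big_split /= lerD //.
  under eq_bigr do rewrite mulrCA.
  rewrite -mulr_sumr (iid_mean sum_ballot_prob _ (fun z => z.1%:R)).
  rewrite (sum_ballot_prob_fst (fun b => b%:R)) big_bool /= mulr1 mulr0 addr0.
  by rewrite mulKf.
under eq_bigr do rewrite mulr_sumr.
rewrite exchange_big /= -!mulrA mulr_suml; apply: ler_sum => j j0.
under eq_bigr do rewrite mulrA.
rewrite -mulr_suml (iid_variance sum_ballot_prob _ (sum_ballot_prob_gap j0)).
rewrite -/(gap_variance j) le_eqVlt; apply/orP; left; apply/eqP; field.
by rewrite n0' lt0r_neq0.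
Qed.

Lemma rule_util_polar_ge0 n : (0 <= rule_util beta f (polar_distribution p) n)%E.
Proof.
rewrite rule_util_polar lee_fin; apply: sumr_ge0 => z _.
by rewrite mulr_ge0 ?winner_util_ge0 // prodr_ge0 // => i _; exact: ballot_prob_ge0.
Qed.

End two_point.

(** * Passage to the limit and choice of the parameters *)

Lemma limn_esup_ge (R : realType) (u : nat -> \bar R) (c : \bar R) :
  (\forall n \near \oo, c <= u n)%E -> (c <= limn_esup u)%E.
Proof.
move=> cu; apply/ereal_infP => _ [A /= FA <-].
(* Every set of the filter meets the set where the bound holds, so the supremum over it is at least
   [c]. *)
have [n [An cn]] := filter_ex (filterI FA cu).
by apply: (le_trans cn); apply: ereal_sup_ubound; exists n.
Qed.

Lemma util_ratio_ge (R : realType) (c a0 r : R) (a b : \bar R) :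
  0 < a0 -> (a0%:E <= a)%E -> (0 <= b <= r%:E)%E -> c * r <= a0 ->
  (c%:E <= util_ratio a b)%E.
Proof.
move=> a0_gt0 aa0 /andP[b0 br] cr.
have a_gt0 : (0 < a)%E by apply: lt_le_trans aa0; rewrite lte_fin.
rewrite /util_ratio gt_eqF //=.
case: b b0 br => // b; rewrite !lee_fin => b0 br.
(* A zero denominator gives [+oo], as the numerator is positive. *)
move: b0; rewrite le_eqVlt => /predU1P[<-|b0].
  by rewrite inve0 gt0_muley // leey.
rewrite inver gt_eqF // lee_pdivlMr // -EFinM (le_trans _ aa0) // lee_fin.
(* A negative [c], which occurs for large [eps], reverses [b <= r]; then [c * b] is negative while
   [a0] is positive. *)
have [c0|c0] := leP 0 c; first by apply: le_trans cr; exact: ler_wpM2l.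
by apply: (le_trans _ (ltW a0_gt0)); rewrite nmulr_rle0 // ltW.
Qed.

(** Here [m] counts the rivals. [K <= m.+1] bounds [K * M] and [K <= M] bounds [K * m], so
    [(K - 2) * (M + m)] is at most [2 * m * M - M - 2 * m]. *)
Lemma top_gap_gt0 (R : realType) (m : nat) (beta K : R) :
  1 < expR beta -> 2 <= K -> K <= expR beta -> K <= m.+1%:R ->
  0 < top_gap m (2 / K) beta.
Proof.
move=> M1 K2 KM Km; rewrite /top_gap mulr_gt0 ?subr_gt0 //.
set M := expR beta in M1 KM *; rewrite -natr1 in Km.
have m0 : 0 <= m%:R :> R by [].
have K0 : K != 0 by lra.
have K_gt0 : 0 < K by lra.
rewrite ltr_pdivrMr; last by nra.
rewrite mulrAC ltr_pdivlMr; last by nra.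
rewrite -(ltr_pM2l K_gt0) [X in X < _](_ : _ = (K - 2) * (M + m%:R)); last by field.
rewrite [X in _ < X](_ : _ = 2 * (1 + m%:R * M)); last by field.
have : K * M <= (m%:R + 1) * M by rewrite ler_wpM2r //; lra.
have : K * m%:R <= M * m%:R by rewrite ler_wpM2r.
lra.
Qed.

Theorem theorem4p1 (R : realType) (m : nat) (beta eps : R)
  (f : voting_rule R m) (m_ge4 : (4 <= m)%N) (beta_ge : ln 4 <= beta)
  (eps_gt0 : 0 < eps) (f_plurality : is_plurality f) :
  ((Num.min (expR beta / (2 + eps) - 1) (m%:R / (2 + eps) - 1))%:E
    <= distortion beta f)%E.
Proof.
case: m => [//|m] in f m_ge4 f_plurality *.
have M4 : 4 <= expR beta by rewrite -[leLHS]lnK ?posrE // ler_expR.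
pose K := Num.min (expR beta) m.+1%:R.
have K4 : 4 <= K by rewrite le_min M4 (ler_nat _ 4).
have KM : K <= expR beta by rewrite ge_min lexx.
have Km : K <= m.+1%:R by rewrite ge_min lexx orbT.
have K_gt0 : 0 < K by lra.
pose c : R := K / (2 + eps) - 1.
(* The map sending [t] to [t / (2 + eps) - 1] is increasing, so it commutes with the minimum. *)
have -> : Num.min (expR beta / (2 + eps) - 1) (m.+1%:R / (2 + eps) - 1) = c.
  rewrite /c /K; case: (leP (expR beta) m.+1%:R) => h.
    by rewrite min_l // lerB // ler_pM2r // invr_gt0; lra.
  by rewrite min_r // lerB // ler_wpM2r ?(ltW h) // invr_ge0; lra.
pose p : R := 2 / K.
have pE : p * K = 2 by rewrite /p; field; lra.
have p1K : (1 - p) * K = K - 2 by rewrite mulrBl mul1r pE.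
have p01 : 0 <= p <= 1.
  by rewrite divr_ge0 ?(ltW K_gt0) //= ler_pdivrMr //; lra.
have gap0 : 0 < top_gap m p beta by apply: top_gap_gt0 => //; lra.
pose C := (\sum_(j : 'I_m.+1 | j != ord0) gap_variance p beta j) / top_gap m p beta ^+ 2.
(* Multiplied by [K] this reads [2 * c < K - 2], strict because [eps > 0]. The slack absorbs the
   error [C / n]. *)
have cp : c * p < 1 - p.
  rewrite -(ltr_pM2r K_gt0) -mulrA pE p1K /c.
  have : K / (2 + eps) * (2 + eps) = K by field; lra.
  have : 0 < K / (2 + eps) by rewrite divr_gt0 //; lra.
  nra.
have p1 : 0 < 1 - p.
  by rewrite -(ltr_pM2r K_gt0) mul0r p1K; lra.
apply: le_trans (ereal_sup_ubound _); last first.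
  by exists (polar_distribution m p) => //; exact: polar_distribution_cube.
apply: limn_esup_ge.
(* The threshold comes from solving [c * (p + C / n) <= 1 - p] for [n]; the successor below ensures
   both [x < n] and [0 < n]. *)
pose x : R := c * C / (1 - p - c * p).
exists (Num.truncn x).+1 => // n /= xn.
have n0 : (0 < n)%N by exact: leq_ltn_trans xn.
apply: (util_ratio_ge (a0 := 1 - p) (r := p + C / n%:R)) => //.
(* Any rival of [ord0] witnesses the value [1 - p] in the maximum. *)
- have j0 : (0 < m)%N by rewrite -ltnS; exact: leq_trans m_ge4.
  apply: le_trans (le_bigmax _ _ (lift ord0 (Ordinal j0))).
  by rewrite util_polar_distribution // lift_eqF.
- by rewrite rule_util_polar_ge0 // rule_util_polar_le.
- have nx : x < n%:R.
    by apply: (lt_le_trans (truncnS_gt x)); rewrite ler_nat.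
  move: nx; rewrite ltr_pdivrMr ?subr_gt0 // => nx.
  by rewrite mulrDr -lerBrDl mulrA ler_pdivrMr ?ltr0n // [leRHS]mulrC ltW.
Qed.
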